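(* Let $p\in\mathbb N$, $\alpha_0>-1$, and let $c_1,\dots,c_p>0$ be pairwise distinct. Let $L_{\vec n}$ and $L^{(i)}_{\vec n}$ ($i=1,\dots,p$) be the multiple Laguerre polynomials of the second kind of type II (monic) and type I given in the context. Let $k\in\{1,\dots,p\}$, let $\pi$ be any permutation of $\{1,\dots,p\}$, and let $\vec s_j$, $S(\pi,j)$, $S^{\mathsf c}(\pi,j)$ be as in the context. Then the nearest-neighbor recurrence relations $$xL_{\vec n}(x)=L_{\vec n+\vec e_k}(x)+b^0_{\vec n}(k)L_{\vec n}(x)+\sum_{j=1}^p b^j_{\vec n}L_{\vec n-\vec s_j}(x),$$ $$xL^{(i)}_{\vec n}(x)=L^{(i)}_{\vec n-\vec e_k}(x)+b^0_{\vec n-\vec e_k}(k)L^{(i)}_{\vec n}(x)+\sum_{j=1}^p b^j_{\vec n+\vec s_{j-1}}L^{(i)}_{\vec n+\vec s_j}(x),\qquad i\in\{1,\dots,p\},$$ hold for all $\vec n\in\mathbb N_0^p$ such that all multi-indices occurring in the respective relation have non-negative entries, where $$b^0_{\vec n}(k)=\frac{\alpha_0+|\vec n|+1}{c_k}+\sum_{i=1}^p\frac{n_i}{c_i},$$ $$b^j_{\vec n}=(-1)^{j+1}(\alpha_0+|\vec n|-j+1)_j\sum_{i\in S(\pi,j)}\frac{n_i}{c_i^{j+1}}\prod_{q\in S^{\mathsf c}(\pi,j)}\frac{c_i-c_q}{c_q},\qquad j\in\{1,\dots,p\}.$$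
   Context: $\mathbb N_0=\{0,1,2,\dots\}$; $|\vec n|=n_1+\cdots+n_p$; $(x)_0=1$, $(x)_n=x(x+1)\cdots(x+n-1)$; empty products equal $1$ and empty sums equal $0$; $\vec e_k$ is the $k$-th canonical basis vector of $\mathbb R^p$. For a permutation $\pi$ of $\{1,\dots,p\}$: $\vec s_0=\vec 0$, $\vec s_j=\sum_{i=1}^j\vec e_{\pi(i)}$, $S(\pi,j)=\{i\in\{1,\dots,p\}: j\le\pi^{-1}(i)\}$, $S^{\mathsf c}(\pi,j)=\{1,\dots,p\}\setminus S(\pi,j)$. The multiple Laguerre polynomials of the second kind are the multiple orthogonal polynomials for the weights $x^{\alpha_0}e^{-c_ix}$, $i=1,\dots,p$, with respect to $dx$ on $[0,\infty)$. Type II (monic, degree $|\vec n|$): $$L_{\vec n}(x)=(-1)^{|\vec n|}(\alpha_0+1)_{|\vec n|}\sum_{l_1=0}^{n_1}\cdots\sum_{l_p=0}^{n_p}\frac{1}{(\alpha_0+1)_{l_1+\cdots+l_p}}\prod_{q=1}^p\frac{(-n_q)_{l_q}c_q^{l_q-n_q}}{l_q!}\;x^{l_1+\cdots+l_p}.$$ Type I: $L^{(i)}_{\vec n}=0$ if $n_i=0$, and if $n_i\ge1$, $$L^{(i)}_{\vec n}(x)=\frac{(-1)^{n_i-1}c_i^{\alpha_0+|\vec n|}(\alpha_0+|\vec n|-n_i+1)_{n_i-1}}{(n_i-1)!\,\Gamma(\alpha_0+|\vec n|)}\prod_{q\ne i}\left(\frac{c_q}{c_q-c_i}\right)^{n_q}\sum_{\substack{l_1,\dots,l_p\ge0\\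 l_1+\cdots+l_p\le n_i-1}}\frac{(-n_i+1)_{l_1+\cdots+l_p}}{(\alpha_0+|\vec n|-n_i+1)_{l_1+\cdots+l_p}}\frac{c_i^{l_1+\cdots+l_p}}{l_i!}\prod_{q\ne i}\frac{(n_q)_{l_q}}{l_q!\,(c_i-c_q)^{l_q}}\;x^{l_i}.$$ *)

(* Defs.v *)
From HB Require Import structures.
From mathcomp Require Import all_boot all_order all_algebra all_fingroup.
From mathcomp Require Import all_classical all_reals all_analysis.

Set Implicit Arguments.
Unset Strict Implicit.
Unset Printing Implicit Defensive.

Import Order.TTheory GRing.Theory Num.Theory.

Local Open Scope ring_scope.

(* Elements of N_0^p; coordinates 1, ..., p of the mathematics are 0, ..., p-1
   here.  Addition is the pointwise nmodType structure of {ffun _ -> nat}. *)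
Definition multiindex (p : nat) := {ffun 'I_p -> nat}.

Definition mabs (p : nat) (n : multiindex p) : nat := (\sum_(i < p) n i)%N.

(* Truncated subtraction: it is the genuine one exactly when mle m n. *)
Definition msub (p : nat) (n m : multiindex p) : multiindex p :=
  [ffun i => (n i - m i)%N].

Definition mle (p : nat) (m n : multiindex p) : Prop :=
  forall i : 'I_p, (m i <= n i)%N.

Definition unitmi (p : nat) (k : 'I_p) : multiindex p :=
  [ffun i => nat_of_bool (i == k)].

(* s_j = e_{pi(1)} + ... + e_{pi(j)}: j is the 1-based index, so the positions
   1, ..., j are the ordinals i < j. *)
Definition svec (p : nat) (pi : 'S_p) (j : nat) : multiindex p :=
  \sum_(i < p | (i < j)%N) unitmi (pi i).

(* S(pi, j) = {i : j <= pi^{-1}(i)} with j and pi^{-1}(i) counted from 1, hence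
   the successor. *)
Definition Sset (p : nat) (pi : 'S_p) (j : nat) : {set 'I_p} :=
  [set i : 'I_p | (j <= ((pi^-1)%g i).+1)%N]%SET.

Section Laguerre.
Variable R : realType.

Definition poch (x : R) (n : nat) : R := \prod_(i < n) (x + i%:R).

Definition Gamma (a : R) : R :=
  \int[lebesgue_measure]_(t in `]0, +oo[) (t `^ (a - 1) * expR (- t)).

Variables (p : nat) (alpha0 : R) (c : 'I_p -> R).

(* The box 0 <= l_q <= n_q is cut out of a common finite range, since
   n_q <= |n|. *)
Definition laguerreII (n : multiindex p) : {poly R} :=
  ((-1) ^+ mabs n * poch (alpha0 + 1) (mabs n)) *:
  \sum_(l : {ffun 'I_p -> 'I_(mabs n).+1} | [forall q, (l q <= n q)%N])
    ((poch (alpha0 + 1) (\sum_(q < p) l q)%N)^-1 *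
     \prod_(q < p)
       (poch (- (n q)%:R) (l q) * c q ^ ((l q)%:Z - (n q)%:Z) / (l q)`!%:R)) *:
    'X^(\sum_(q < p) l q)%N.

(* l_1 + ... + l_p <= n_i - 1 forces each l_q < n_i. *)
Definition laguerreI (i : 'I_p) (n : multiindex p) : {poly R} :=
  if n i == 0%N then 0 else
  ((-1) ^+ (n i - 1) * c i `^ (alpha0 + (mabs n)%:R)
     * poch (alpha0 + (mabs n)%:R - (n i)%:R + 1) (n i - 1)
     / ((n i - 1)`!%:R * Gamma (alpha0 + (mabs n)%:R))
     * \prod_(q < p | q != i) (c q / (c q - c i)) ^+ n q) *:
  \sum_(l : {ffun 'I_p -> 'I_(n i)} | (\sum_(q < p) l q <= n i - 1)%N)
    (poch (- (n i)%:R + 1) (\sum_(q < p) l q)%N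
       / poch (alpha0 + (mabs n)%:R - (n i)%:R + 1) (\sum_(q < p) l q)%N
       * (c i ^+ (\sum_(q < p) l q)%N / (l i)`!%:R)
       * \prod_(q < p | q != i)
           (poch (n q)%:R (l q) / ((l q)`!%:R * (c i - c q) ^+ l q))) *:
    'X^(l i).

Definition coef_b0 (k : 'I_p) (n : multiindex p) : R :=
  (alpha0 + (mabs n)%:R + 1) / c k + \sum_(i < p) (n i)%:R / c i.

Definition coef_b (pi : 'S_p) (j : nat) (n : multiindex p) : R :=
  (-1) ^+ j.+1 * poch (alpha0 + (mabs n)%:R - j%:R + 1) j *
  \sum_(i in Sset pi j)
    ((n i)%:R / c i ^+ j.+1 *
     \prod_(q in (~: Sset pi j)%SET) ((c i - c q) / c q)).

End Laguerre.

(* Main.v *)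
Require Import Defs.
From HB Require Import structures.
From mathcomp Require Import all_boot all_order all_algebra all_fingroup.
From mathcomp Require Import all_classical all_reals all_analysis.
From mathcomp Require Import measurable_realfun ring lra zify.

Set Implicit Arguments.
Unset Strict Implicit.
Unset Printing Implicit Defensive.

Import Order.TTheory GRing.Theory Num.Theory.
Import numFieldNormedType.Exports.

Local Open Scope ring_scope.

(** Write [a_q = 1 / c_q], [N = |n|], and
    [Q_n(y) = \prod_q (y - a_q) ^ n_q] (the polynomial [nodal] below).  Both
    families of polynomials are linear images of [Q_n] and of [1 / Q_n], and
    both recurrences are the image of one identity of rational functions.

    Type II.  Let [T] be the linear map sending [y ^ m] to
    [x ^ m / (alpha0 + 1)_m] ([pochdiv]).  Expanding [Q_n] by the binomial
    formula gives [L_n = (alpha0 + 1)_N T(Q_n)] ([laguerreII_nodal]), and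
    [x T(f) = T((alpha0 + 1) y f + y^2 f')] ([mulX_pochdiv]).

    Type I.  The polynomial [L_n^(i)] is [- 1 / Gamma(alpha0 + N)] times the
    residue at [t = c_i] of
    [exp (- x (t - c_i)) t ^ (alpha0 - 1) / Q_n(1 / t)]
    ([laguerreI_residue]).  Multiplying by [x] amounts to differentiating the
    exponential, and the residue of a derivative vanishes, so the derivative
    may be moved onto the other factor.

    In both cases, with [y = 1 / t] for type I, the result is a multiple of
    [y] plus
    [y^2 Q_n'(y) / Q_n(y) = N y + \sum_i n_i a_i
       + \sum_i n_i a_i^2 / (y - a_i)],
    because [y^2 / (y - a) = y + a + a^2 / (y - a)].  The terms without pole
    give the neighbour in direction [k] and the coefficient [b^0], since
    [y = (y - a_k) + a_k].  It remains to expand [1 / (y - a_i)] by Newton's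
    interpolation formula along the nodes [a_pi(1), a_pi(2), ...]:
    [1 / (y - a_i) = \sum_(j <= pi^-1(i))
       \prod_(r < j) (a_i - a_pi(r)) / \prod_(r <= j) (y - a_pi(r))],
    which is the sum over the path [s_1, s_2, ...] in the theorem
    ([sum_newton_expansion]).  The Pochhammer factor of [b^j] is the quotient
    of the normalisations [(alpha0 + 1)_N], respectively of the Gamma values,
    at the two ends of the step. *)

(** * The functional equation of the Gamma function *)

Section GammaFunction.
Local Open Scope classical_set_scope.
Variable R : realType.
Local Notation mu := (@lebesgue_measure R).

Lemma cvg_inv_shift2 : n.+2%:R^-1 @[n --> \oo] --> (0 : R).
Proof. by have := @cvg_harmonic R; rewrite -cvg_shiftS; exact. Qed.

(** The exponential beats every power: [t ^ N / exp t <= (N + 1)! / t]. *)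
Lemma powR_exp_decay (a : R) : 0 < a ->
  n.+2%:R `^ a * expR (- n.+2%:R) @[n --> \oo] --> (0 : R).
Proof.
move=> a0.
have [N aN] : exists N : nat, a <= N%:R.
  by exists (Num.truncn a).+1; rewrite ltW// truncnS_gt.
apply: (@squeeze_cvgr _ _ _ _ (cst 0) (fun n => N.+1`!%:R * n.+2%:R^-1)).
- near=> n.
  rewrite mulr_ge0 ?powR_ge0 ?expR_ge0//=.
  have n0 : (0 : R) < n.+2%:R by rewrite ltr0n.
  have h1 : n.+2%:R `^ a <= n.+2%:R ^+ N :> R.
    by rewrite -powR_mulrn ?ler0n// ler_powR// ler1n.
  apply: (le_trans (ler_wpM2r (expR_ge0 _) h1)).
  rewrite expRN ler_pdivrMr ?expR_gt0// mulrAC ler_pdivlMr// -exprSr.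
  rewrite mulrC -ler_pdivrMr ?ltr0n ?fact_gt0//.
  by apply: le_trans (expR_ge1Dxn N (ltW n0)); rewrite lerDr.
- exact: cvg_cst.
- rewrite -[X in _ --> X](mulr0 (N.+1`!%:R : R)).
  apply: cvgM; first exact: cvg_cst.
  exact: cvg_inv_shift2.
Unshelve. all: end_near. Qed.

Lemma continuous_expRN : continuous (fun x : R => expR (- x)).
Proof.
move=> x; apply: continuous_comp; first exact: opp_continuous.
exact: continuous_expR.
Qed.

Lemma powR_exp_near0 (a : R) : 0 < a ->
  (n.+2%:R^-1) `^ a * expR (- n.+2%:R^-1) @[n --> \oo] --> (0 : R).
Proof.
move=> a0; rewrite -[X in _ --> X](mul0r (expR (- 0) : R)).
apply: cvgM.
  apply: ((cvg_at_rightP _ _ _).1 (powR_cvg0 a0)); split.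
    by move=> n; rewrite invr_gt0 ltr0n.
  exact: cvg_inv_shift2.
by have := cvg_comp _ _ cvg_inv_shift2 (@continuous_expRN 0); apply.
Qed.

Lemma continuous_powR_pos (s x : R) : 0 < x ->
  {for x, continuous (fun t : R => t `^ s)}.
Proof.
move=> x0; apply/differentiable_continuous/derivable1_diffP.
by apply: derivable_powR; rewrite in_itv/= x0.
Qed.

Definition gamma_integrand (s t : R) : R := t `^ (s - 1) * expR (- t).

Lemma measurable_gamma_integrand (s : R) (D : set R) :
  measurable_fun D (gamma_integrand s).
Proof.
apply: measurable_funTS; apply: measurable_funM.
  exact: measurable_powR.
by apply: measurableT_comp; [exact: measurable_expR | exact: oppr_measurable].
Qed.

Lemma is_derive_expRN (x : R) :
  is_derive x 1 (fun t : R => - expR (- t)) (expR (- x)).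
Proof.
have -> : (fun t : R => - expR (- t)) = - (expR \o -%R) by [].
apply: is_derive_eq.
by rewrite mulrN1 opprK.
Qed.

(** The integrand may be unbounded near 0, so the integration by parts is done
    on a segment away from 0.  It is stated in the extended reals: the limit
    below then needs no proof that the Gamma integral is finite. *)
Lemma gamma_integrand_by_parts (s a b : R) : 0 < s -> 0 < a -> a < b ->
  (\int[mu]_(t in `[a, b]) (gamma_integrand (s + 1) t)%:E =
   (a `^ s * expR (- a) - b `^ s * expR (- b))%:E
   + s%:E * \int[mu]_(t in `[a, b]) (gamma_integrand s t)%:E)%E.
Proof.
move=> s0 a0 ab.
have xin x : x \in `]a, b[%R -> 0 < x.
  by rewrite in_itv/= => /andP[ax _]; exact: lt_trans ax.
have xcc x : x \in `[a, b]%R -> 0 < x.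
  by rewrite in_itv/= => /andP[ax _]; exact: lt_le_trans ax.
have LR (F : R -> R) : (forall x, 0 < x -> derivable F x 1) ->
    derivable_oo_LRcontinuous F a b.
  move=> dF; split; first by move=> x /xin /dF.
  - apply: cvg_at_right_filter.
    by apply/differentiable_continuous/derivable1_diffP/dF.
  - apply: cvg_at_left_filter; apply/differentiable_continuous/derivable1_diffP/dF.
    exact: lt_trans ab.
rewrite /gamma_integrand addrK.
rewrite (@integration_by_parts R (fun t => t `^ s) (fun t => - expR (- t))
  (fun t => s * t `^ (s - 1)) (fun t => expR (- t)) a b ab); first last.
- move=> x _; rewrite derive1E.
  exact: (@derive_val _ _ _ _ _ _ _ (is_derive_expRN _)).
- by apply: LR => x _; exact: (@ex_derive _ _ _ _ _ _ _ (is_derive_expRN _)).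
- apply: continuous_in_subspaceT => x _.
  exact: continuous_expRN.
- by move=> x /xin x0; rewrite powR_derive1// in_itv/= x0.
- by apply: LR => x x0; apply: derivable_powR; rewrite in_itv/= x0.
- apply: continuous_in_subspaceT => x; rewrite inE => /xcc x0.
  by apply: cvgM; [exact: cvg_cst | exact: continuous_powR_pos].
have gE : (\int[mu]_(x in `[a, b]) (s * x `^ (s - 1) * - expR (- x))%:E =
   - (s%:E * \int[mu]_(t in `[a, b]) (t `^ (s - 1) * expR (- t))%:E))%E.
  rewrite -ge0_integralZl_EFin//; last 3 first.
  - by move=> x _; rewrite lee_fin mulr_ge0 ?powR_ge0 ?expR_ge0.
  - by apply/measurable_EFinP; exact: measurable_gamma_integrand.
  - exact: ltW.
  rewrite -integral_ge0N//=.
    apply: eq_integral => x _.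
    by rewrite mulrN mulrA.
  by move=> x _; rewrite lee_fin !mulr_ge0 ?powR_ge0 ?expR_ge0// ltW.
rewrite gE oppeK; congr (_%:E + _)%E.
by rewrite !mulrN opprK addrC.
Qed.

(** Exhaust the half-line by the segments [1/(n+2), n+2]: the boundary terms
    tend to 0 and the integrals converge by monotonicity. *)
Lemma Gamma_add1 (s : R) : 0 < s -> Gamma (s + 1) = s * Gamma s.
Proof.
move=> s0.
pose I (n : nat) : set R := `[n.+2%:R^-1, n.+2%:R].
have UI : \bigcup_n I n = `]0, +oo[.
  apply/seteqP; split => x /=.
    move=> [n _]; rewrite /I/= !in_itv/= andbT => /andP[h _].
    by apply: lt_le_trans h; rewrite invr_gt0.
  rewrite in_itv/= andbT => x0.
  exists (maxn (Num.truncn x) (Num.truncn x^-1)) => //=.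
  rewrite /I/= in_itv/=; apply/andP; split.
    rewrite -[leRHS]invrK lef_pV2 ?posrE ?invr_gt0 ?ltr0n//.
    apply: ltW; apply: lt_le_trans (truncnS_gt _) _.
    by rewrite ler_nat ltnS ltnW// ltnS leq_maxr.
  apply: ltW; apply: lt_le_trans (truncnS_gt _) _.
  by rewrite ler_nat ltnS ltnW// ltnS leq_maxl.
have cI r : (\int[mu]_(t in I n) (gamma_integrand r t)%:E)%E @[n --> \oo] -->
    (\int[mu]_(t in `]0%R, +oo[) (gamma_integrand r t)%:E)%E.
  rewrite -UI; apply: ge0_nondecreasing_set_cvg_integral.
  - move=> m n mn; apply/subsetPset => x; rewrite /I/= !in_itv/= => /andP[h1 h2].
    rewrite (le_trans _ h1)/=.
      by rewrite (le_trans h2)// ler_nat !ltnS.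
    by rewrite lef_pV2 ?posrE ?ltr0n// ler_nat !ltnS.
  - by move=> n; exact: measurable_itv.
  - by move=> n; apply/measurable_EFinP; exact: measurable_gamma_integrand.
  - by move=> n x _; rewrite lee_fin mulr_ge0 ?powR_ge0 ?expR_ge0.
have E : (\int[mu]_(t in `]0%R, +oo[) (gamma_integrand (s + 1) t)%:E =
    s%:E * \int[mu]_(t in `]0%R, +oo[) (gamma_integrand s t)%:E)%E.
  rewrite -[RHS]add0e; apply: (cvg_unique _ (cI (s + 1))) => //.
  have -> : (fun n => \int[mu]_(t in I n) (gamma_integrand (s + 1) t)%:E)%E =
    (fun n => (n.+2%:R^-1 `^ s * expR (- n.+2%:R^-1)
       - n.+2%:R `^ s * expR (- n.+2%:R))%:E
      + s%:E * \int[mu]_(t in I n) (gamma_integrand s t)%:E)%E.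
    apply/funext => n; rewrite /I gamma_integrand_by_parts ?invr_gt0//.
    by rewrite (@lt_trans _ _ 1)// ?ltr1n// invf_lt1// ltr1n.
  apply: cvgeD; first by rewrite fin_num_adde_defr.
    apply: cvg_EFin; first exact: nearW.
    rewrite -[X in _ --> X](subrr (0 : R)).
    by apply: cvgB; [exact: powR_exp_near0 | exact: powR_exp_decay].
  by apply: cvgeZl.
rewrite /Gamma /Rintegral.
have := congr1 fine E; rewrite /gamma_integrand => ->.
set I0 := (\int[mu]_(t in _) _)%E.
case: I0 => [r||] //=; first by rewrite mulr0 gt0_muley ?lte_fin.
by rewrite mulr0 gt0_muleNy ?lte_fin.
Qed.

End GammaFunction.

(** * Multi-indices and the path [svec] *)

Section Multiindices.
Variable p : nat.
Implicit Types n m : multiindex p.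

Lemma miE n m i : (n + m) i = (n i + m i)%N.
Proof. by rewrite ffunE. Qed.

Lemma msubE n m i : msub n m i = (n i - m i)%N.
Proof. by rewrite ffunE. Qed.

Lemma unitmiE (k i : 'I_p) : unitmi k i = (i == k).
Proof. by rewrite ffunE. Qed.

Lemma mabsD n m : mabs (n + m) = (mabs n + mabs m)%N.
Proof. by rewrite /mabs -big_split; apply: eq_bigr => i _; rewrite miE. Qed.

Lemma mabs_unitmi (k : 'I_p) : mabs (unitmi k) = 1%N.
Proof.
rewrite /mabs (bigD1 k)//= unitmiE eqxx big1 // => i /negPf ik.
by rewrite unitmiE ik.
Qed.

Lemma msubK n m : mle m n -> msub n m + m = n.
Proof. by move=> h; apply/ffunP => i; rewrite miE ffunE subnK. Qed.

Lemma mabs_msub n m : mle m n -> mabs (msub n m) = (mabs n - mabs m)%N.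
Proof. by move=> /msubK {2}<-; rewrite mabsD addnK. Qed.

Lemma mle_unitmi (k : 'I_p) n : mle (unitmi k) n <-> (0 < n k)%N.
Proof.
split=> [/(_ k)|h i]; first by rewrite unitmiE eqxx.
by rewrite unitmiE; case: eqP => // ->.
Qed.

Variable pi : 'S_p.

Lemma svecE j i : svec pi j i = ((pi^-1)%g i < j)%N.
Proof.
rewrite /svec sum_ffunE.
under eq_bigr do rewrite unitmiE.
rewrite (reindex_inj (@perm_inj _ (pi^-1)%g))/=.
under eq_bigr do rewrite permKV.
rewrite big_mkcond/= (bigD1 i)//= eqxx big1 ?addn0; first by case: ifP.
by move=> q /negPf qi; rewrite eq_sym qi; case: ifP.
Qed.

Lemma svec0 : svec pi 0 = 0.
Proof. by apply/ffunP => i; rewrite svecE ffunE. Qed.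

Lemma svecS (r : 'I_p) : svec pi r.+1 = svec pi r + unitmi (pi r).
Proof.
apply/ffunP => i; rewrite miE !svecE unitmiE ltnS leq_eqVlt.
have -> : ((pi^-1)%g i == r :> nat) = (i == pi r).
  by apply/eqP/eqP => [/val_inj <-|->]; rewrite ?permKV ?permK.
by case: (eqVneq i (pi r)) => [->|_]; rewrite ?permK ?ltnn ?addn0.
Qed.

Lemma mabs_svec j : (j <= p)%N -> mabs (svec pi j) = j.
Proof.
elim: j => [|j IH] jp; first by rewrite svec0 /mabs big1// => i _; rewrite ffunE.
by rewrite (svecS (Ordinal jp)) mabsD mabs_unitmi IH ?addn1// ltnW.
Qed.

Lemma in_Sset j (i : 'I_p) : (i \in Sset pi j) = (j <= ((pi^-1)%g i).+1)%N.
Proof. by rewrite inE. Qed.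

Lemma prod_Sset_compl (A : comNzRingType) j (f : 'I_p -> A) :
  \prod_(q in (~: Sset pi j.+1)%SET) f q = \prod_(r < p | (r < j)%N) f (pi r).
Proof.
rewrite (reindex_inj (@perm_inj _ pi))/=; apply: eq_bigl => r.
by rewrite inE in_Sset permK -ltnNge.
Qed.

Lemma card_Sset_compl j : (j <= p)%N -> #|(~: Sset pi j.+1)%SET| = j.
Proof.
move=> jp; rewrite -[RHS](mabs_svec jp) -sum1_card big_mkcond.
by apply: eq_bigr => i _; rewrite svecE inE in_Sset -ltnNge ltnS; case: ifP.
Qed.

End Multiindices.

(** * Newton expansion along the path *)

Section Newton.
Variables (R : fieldType) (p : nat) (pi : 'S_p) (V : lmodType R).

(** In the application [X j] stands for [1 / \prod_(r < j) (y - b_r)] and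
    [Y j] for [X j / (y - a)], where [B r = a - b_r]; the step hypothesis is
    the partial fraction identity
    [1 / (y - a) = 1 / (y - b) + (a - b) / ((y - a) (y - b))], and the last one
    says that the node [b_J] is [a] itself. *)
Lemma newton_expansion (B : 'I_p -> R) (X Y : nat -> V) (J : 'I_p) :
  (forall r : 'I_p, (r < J)%N -> Y r = X r.+1 + B r *: Y r.+1) ->
  Y J = X J.+1 ->
  Y 0 = \sum_(0 <= j < J.+1) (\prod_(r < p | (r < j)%N) B r) *: X j.+1.
Proof.
move=> step last_step.
have partial j : (j <= J)%N -> Y 0 =
    \sum_(0 <= i < j) (\prod_(r < p | (r < i)%N) B r) *: X i.+1
    + (\prod_(r < p | (r < j)%N) B r) *: Y j.
  elim: j => [|j IH] jJ; first by rewrite big_geq// add0r big1 ?scale1r.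
  have jp : (j < p)%N by apply: leq_trans jJ (ltnW (ltn_ord J)).
  rewrite IH ?(ltnW jJ)// big_nat_recr//= -addrA; congr (_ + _).
  rewrite (step (Ordinal jp) jJ)/= scalerDr scalerA; congr (_ + _ *: _).
  rewrite (bigD1 (Ordinal jp) (P := fun r : 'I_p => r < j.+1)%N)//= mulrC.
  congr (_ * _); apply: eq_bigl => r.
  by rewrite ltnS -val_eqE/= andbC ltn_neqAle.
by rewrite big_nat_recr//= -last_step -partial.
Qed.

(** The node [a i] is met at step [pi^-1 i] of the path, where its expansion
    stops; exchanging the two sums leaves, for given [j], the indices [i] not
    yet met, which form [Sset pi j]. *)
Lemma sum_newton_expansion (a w : 'I_p -> R) (X : nat -> V)
    (Y : 'I_p -> nat -> V) :
  (forall i r : 'I_p, (r < (pi^-1)%g i)%N ->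
     Y i r = X r.+1 + (a i - a (pi r)) *: Y i r.+1) ->
  (forall i : 'I_p, Y i ((pi^-1)%g i) = X ((pi^-1)%g i).+1) ->
  \sum_i w i *: Y i 0 =
  \sum_(1 <= j < p.+1) (\sum_(i in Sset pi j)
     w i * \prod_(q in (~: Sset pi j)%SET) (a i - a q)) *: X j.
Proof.
move=> step last_step.
have E i : Y i 0 = \sum_(0 <= j < p | (j <= (pi^-1)%g i)%N)
    (\prod_(r < p | (r < j)%N) (a i - a (pi r))) *: X j.+1.
  rewrite (newton_expansion (step i) (last_step i)).
  by rewrite (big_nat_widen _ _ p); [apply: eq_bigl | exact: ltn_ord].
rewrite big_add1/=.
under eq_bigr => i _ do rewrite E scaler_sumr big_mkcond.
rewrite exchange_big/=; apply: eq_bigr => j _.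
rewrite scaler_suml [RHS]big_mkcond; apply: eq_bigr => i _.
rewrite in_Sset ltnS; case: ifP => // _.
by rewrite prod_Sset_compl scalerA.
Qed.

End Newton.

(** * Pochhammer symbols and derivatives of products *)

Section Pochhammer.
Variable R : realType.
Implicit Types (x : R).

Lemma pochS x n : poch x n.+1 = poch x n * (x + n%:R).
Proof. by rewrite /poch big_ord_recr. Qed.

Lemma pochSl x n : poch x n.+1 = x * poch (x + 1) n.
Proof.
rewrite /poch big_ord_recl addr0; congr (_ * _).
by apply: eq_bigr => j _; rewrite -addrA -natr1 [1 + _]addrC.
Qed.

Lemma pochD x m n : poch x (m + n) = poch x m * poch (x + m%:R) n.
Proof.
elim: n => [|n IH]; first by rewrite addn0 /poch big_ord0 mulr1.
by rewrite addnS !pochS IH natrD -mulrA addrA.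
Qed.

Lemma poch_gt0 x n : 0 < x -> 0 < poch x n.
Proof. by move=> x0; apply: prodr_gt0 => i _; rewrite ltr_pwDl. Qed.

Lemma poch_opp x m : poch (- x) m = (-1) ^+ m * poch (x - m%:R + 1) m.
Proof.
have -> : (-1) ^+ m = \prod_(j < m) -1 :> R by rewrite prodr_const card_ord.
rewrite /poch (reindex_inj rev_ord_inj)/= -big_split; apply: eq_bigr => j _ /=.
by rewrite natrB// -natr1; ring.
Qed.

Lemma poch_opp_nat (n l : nat) :
  poch (- n%:R : R) l = (-1) ^+ l * (n ^_ l)%:R.
Proof.
elim: l => [|l IH]; first by rewrite /poch big_ord0 ffactn0 mulr1.
rewrite pochS IH ffactnSr natrM exprS.
have [nl|ln] := ltnP n l; first by rewrite ffact_small// !(mul0r, mulr0).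
by rewrite natrB//; ring.
Qed.

End Pochhammer.

Lemma deriv_prod (A : comNzRingType) (I : finType) (P : pred I)
    (F : I -> {poly A}) :
  (\prod_(i | P i) F i)^`() =
  \sum_(i | P i) (F i)^`() * \prod_(j | P j && (j != i)) F j.
Proof.
have : uniq (index_enum I) by exact: index_enum_uniq.
elim: (index_enum I) => [|x r IH /= /andP[xr ur]].
  by rewrite !big_nil derivC.
have neq j : j \in r -> (j != x) by move=> jr; apply: contraNneq xr => <-.
have xprod : \prod_(j <- r | P j && (j != x)) F j = \prod_(j <- r | P j) F j.
  rewrite big_seq_cond [RHS]big_seq_cond; apply: eq_bigl => j.
  by case jr: (j \in r) => //=; rewrite neq// andbT.
rewrite !big_cons; case: ifP => Px; last first.
  rewrite IH//; apply: eq_bigr => i _; rewrite big_cons Px/=//.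
rewrite derivM IH// eqxx andbF xprod; congr (_ + _).
rewrite big_distrr/= big_seq_cond [RHS]big_seq_cond.
apply: eq_bigr => i /andP[ir _]; rewrite big_cons Px eq_sym neq//=.
by rewrite mulrCA.
Qed.

(** * Type II polynomials *)

Section TypeII.
Variables (R : realType) (p : nat) (alpha0 : R) (c : 'I_p -> R).
Hypothesis halpha0 : -1 < alpha0.
Hypothesis hc : forall i, 0 < c i.

Let alpha1_gt0 : 0 < alpha0 + 1. Proof. by rewrite -ltrBlDr sub0r. Qed.

Definition nodal (n : multiindex p) : {poly R} :=
  \prod_(q < p) ('X - ((c q)^-1)%:P) ^+ n q.

(** Division of the coefficients by the moments of [x ^ alpha0 exp (- x)],
    normalised by the moment of order 0. *)
Definition pochdiv (f : {poly R}) : {poly R} :=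
  \poly_(m < size f) (f`_m / poch (alpha0 + 1) m).

Lemma coef_pochdiv f m : (pochdiv f)`_m = f`_m / poch (alpha0 + 1) m.
Proof.
rewrite coef_poly; case: ltnP => // h.
by rewrite nth_default ?mul0r.
Qed.

Lemma pochdiv_is_linear : linear pochdiv.
Proof.
move=> k f g; apply/polyP => m.
by rewrite !(coefD, coefZ, coef_pochdiv) mulrDl mulrA.
Qed.

HB.instance Definition _ :=
  GRing.isLinear.Build R {poly R} {poly R} *:%R pochdiv pochdiv_is_linear.

Lemma pochdivXn m : pochdiv 'X^m = (poch (alpha0 + 1) m)^-1 *: 'X^m.
Proof.
apply/polyP => k; rewrite coef_pochdiv coefZ coefXn.
by case: eqP => [->|_]; rewrite ?mul1r ?mulr1 ?mul0r ?mulr0.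
Qed.

(** On monomials this is [(alpha0 + 1 + m) / (alpha0 + 1)_(m+1) =
    1 / (alpha0 + 1)_m], the factor [m] being produced by [y d/dy]. *)
Lemma mulX_pochdiv f :
  'X * pochdiv f = pochdiv ((alpha0 + 1) *: ('X * f) + 'X^2 * f^`()).
Proof.
apply/polyP => [[|m]].
  by rewrite coef_pochdiv coefD coefZ expr2 -!mulrA !coefXM !mulr0 addr0 mul0r.
rewrite coef_pochdiv coefD coefZ expr2 -mulrA !(coefXM _ m.+1)/= coef_pochdiv.
have -> : ('X * f^`())`_m = f`_m *+ m.
  by rewrite coefXM; case: m => [|m]; rewrite ?mulr0n ?coef_deriv.
rewrite pochS -(mulr_natr f`_m).
have -> : (alpha0 + 1) * f`_m + f`_m * m%:R = f`_m * (alpha0 + 1 + m%:R).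
  by ring.
rewrite invfM mulrACA mulfV ?mulr1//.
by rewrite gt_eqF// ltr_pwDl.
Qed.

(** One coordinate of the coefficient of [L_n], sign included, is a term of the
    binomial expansion of [(y - 1/x) ^ n]. *)
Lemma laguerreII_factor (n l : nat) (x : R) : 0 < x -> (l <= n)%N ->
  (-1) ^+ n * (poch (- n%:R) l * x ^ (l%:Z - n%:Z) / l`!%:R) =
  (- x^-1) ^+ (n - l) * 'C(n, l)%:R.
Proof.
move=> x0 ln; rewrite poch_opp_nat -bin_ffact natrM.
have -> : x ^ (l%:Z - n%:Z) = x^-1 ^+ (n - l).
  by rewrite -opprB subzn// -exprnN exprVn.
have -> : (-1) ^+ n = (-1) ^+ (n - l) * (-1) ^+ l :> R.
  by rewrite -exprD subnK.
have -> : (- x^-1) ^+ (n - l) = (-1) ^+ (n - l) * x^-1 ^+ (n - l).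
  by rewrite -exprMn mulN1r.
have f0 : l`!%:R != 0 :> R by rewrite pnatr_eq0 -lt0n fact_gt0.
transitivity ((-1) ^+ (n - l) * ((-1) ^+ l * (-1) ^+ l) * x^-1 ^+ (n - l)
   * 'C(n, l)%:R * (l`!%:R / l`!%:R) : R); first by ring.
by rewrite -exprMn mulrNN mul1r expr1n divff// !mulr1.
Qed.

Lemma laguerreII_nodal n :
  laguerreII alpha0 c n =
  poch (alpha0 + 1) (mabs n) *: pochdiv (nodal n).
Proof.
have nq q : (n q <= mabs n)%N by rewrite /mabs (bigD1 q)//= leq_addr.
have facE q : ('X - ((c q)^-1)%:P) ^+ n q =
   \sum_(l < (mabs n).+1 | (l <= n q)%N)
     ((- (c q)^-1) ^+ (n q - l) * 'C(n q, l)%:R) *: 'X^l :> {poly R}.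
  rewrite addrC exprDn (big_ord_widen _ (fun l : nat =>
    ((- ((c q)^-1)%:P) ^+ (n q - l) * 'X^l *+ 'C(n q, l)))
    (nq q : n q < (mabs n).+1)%N)//.
  apply: eq_bigr => l _; rewrite -scaler_nat -rmorphN -rmorphXn/= mul_polyC.
  by rewrite scalerA mulrC.
rewrite /nodal; under eq_bigr do rewrite facE.
rewrite bigA_distr_big_dep/= linear_sum/= /laguerreII [_ * poch _ _]mulrC.
rewrite -scalerA; congr (_ *: _); rewrite scaler_sumr.
apply: eq_big => [l|l /forallP hl].
  by apply/forallP/familyP => h q; have := h q.
rewrite [in RHS]scaler_prod prodrXr [in RHS]linearZ/= pochdivXn !scalerA.
congr (_ *: _); rewrite mulrA mulrAC; congr (_ * _).
rewrite /mabs -prodrXr -big_split/=; apply: eq_bigr => q _.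
by rewrite laguerreII_factor.
Qed.

Lemma nodalD n k : nodal (n + unitmi k) = ('X - ((c k)^-1)%:P) * nodal n.
Proof.
rewrite /nodal (bigD1 k)//= [X in _ = _ * X](bigD1 k)//= mulrA -exprS.
rewrite miE unitmiE eqxx addn1; congr (_ * _).
by apply: eq_bigr => q /negPf qk; rewrite miE unitmiE qk addn0.
Qed.

Lemma deriv_nodal n :
  (nodal n)^`() = \sum_i (n i)%:R *: nodal (msub n (unitmi i)).
Proof.
rewrite /nodal deriv_prod; apply: eq_bigr => i _.
rewrite deriv_exp derivXsubC mul1r [in RHS](bigD1 i)//= scaler_nat.
rewrite -mulrnAl ffunE unitmiE eqxx subn1; congr (_ * _).
by apply: eq_bigr => q /negPf qi; rewrite ffunE unitmiE qi subn0.
Qed.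

(** The logarithmic derivative of [nodal n], with
    [y^2 = (y + a_i) (y - a_i) + a_i^2] in the term of index [i]. *)
Lemma mulXsq_deriv_nodal n :
  'X^2 * (nodal n)^`() =
  (mabs n)%:R *: ('X * nodal n) + (\sum_i (n i)%:R / c i) *: nodal n
  + \sum_i ((n i)%:R * (c i)^-1 ^+ 2) *: nodal (msub n (unitmi i)).
Proof.
rewrite deriv_nodal mulr_sumr /mabs natr_sum !scaler_suml -!big_split/=.
apply: eq_bigr => i _; case: (posnP (n i)) => [->|ni].
  by rewrite !mul0r !scale0r mulr0 !addr0.
have -> : nodal n = ('X - ((c i)^-1)%:P) * nodal (msub n (unitmi i)).
  by rewrite -nodalD msubK//; exact/mle_unitmi.
rewrite -!mul_polyC expr2 !rmorphM/=; ring.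
Qed.

Lemma mulX_laguerreII n :
  'X * laguerreII alpha0 c n = poch (alpha0 + 1) (mabs n) *: pochdiv
    ((alpha0 + 1 + (mabs n)%:R) *: ('X * nodal n)
     + (\sum_i (n i)%:R / c i) *: nodal n
     + \sum_i ((n i)%:R * (c i)^-1 ^+ 2) *: nodal (msub n (unitmi i))).
Proof.
rewrite laguerreII_nodal -scalerAr mulX_pochdiv mulXsq_deriv_nodal.
by rewrite !addrA -scalerDl.
Qed.

Lemma laguerreII_unitD n k : laguerreII alpha0 c (n + unitmi k) =
  (poch (alpha0 + 1) (mabs n) * (alpha0 + 1 + (mabs n)%:R)) *:
  pochdiv ('X * nodal n - (c k)^-1 *: nodal n).
Proof.
rewrite laguerreII_nodal mabsD mabs_unitmi addn1 pochS nodalD mulrBl.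
by rewrite mul_polyC.
Qed.

End TypeII.

(** Since [(c_i - c_q) / (c_q c_i) = a_q - a_i] and the complement of
    [Sset pi j] has [j - 1] elements, the powers of [c_i] and the sign of [b^j]
    turn its products into the coefficients of the Newton expansion. *)
Lemma coef_bE (R : realType) (p : nat) (alpha0 : R) (c : 'I_p -> R)
    (pi : 'S_p) (j : nat) (n : multiindex p) :
  (forall i, c i != 0) -> (0 < j <= p)%N ->
  coef_b alpha0 c pi j n = poch (alpha0 + (mabs n)%:R - j%:R + 1) j *
  \sum_(i in Sset pi j) ((n i)%:R * (c i)^-1 ^+ 2 *
     \prod_(q in (~: Sset pi j)%SET) ((c i)^-1 - (c q)^-1)).
Proof.
move=> c0; case: j => [//|j] /= jp; rewrite /coef_b mulrAC mulrC.
congr (_ * _); rewrite mulr_sumr; apply: eq_bigr => i _.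
have cardS := card_Sset_compl pi (ltnW jp).
have -> : \prod_(q in (~: Sset pi j.+1)%SET) ((c i)^-1 - (c q)^-1) =
  (- (c i)^-1) ^+ j * \prod_(q in (~: Sset pi j.+1)%SET) ((c i - c q) / c q).
  have -> : (- (c i)^-1) ^+ j = \prod_(q in (~: Sset pi j.+1)%SET) - (c i)^-1.
    by rewrite prodr_const cardS.
  rewrite -big_split; apply: eq_bigr => q _ /=.
  by field; rewrite !c0.
rewrite (exprNn (c i)^-1) -!exprVn !exprS; ring.
Qed.

Theorem laguerreII_recurrence (R : realType) (p : nat) (alpha0 : R)
    (c : 'I_p -> R) (k : 'I_p) (pi : 'S_p) (n : multiindex p) :
  -1 < alpha0 -> (forall i, 0 < c i) ->
  (forall j : nat, (1 <= j <= p)%N -> mle (svec pi j) n) ->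
  'X * laguerreII alpha0 c n =
    laguerreII alpha0 c (n + unitmi k)
    + coef_b0 alpha0 c k n *: laguerreII alpha0 c n
    + \sum_(1 <= j < p.+1)
        coef_b alpha0 c pi j n *: laguerreII alpha0 c (msub n (svec pi j)).
Proof.
move=> a1 c_gt0 hn.
have c0 i : c i != 0 by rewrite gt_eqF.
have hs j : (j <= p)%N -> mle (svec pi j) n.
  by case: j => [|j] jp; [rewrite svec0 => i; rewrite ffunE | exact: hn].
(* X j is Q_n divided by the factors of the first j nodes, Y i j is X j divided
   by y - a_i.  The divisions used are exact: every entry of n is positive, and
   Y i j only matters as long as the path has not reached i. *)
pose X j := nodal c (msub n (svec pi j)).
pose Y i j := nodal c (msub n (svec pi j + unitmi i)).
have := @sum_newton_expansion R p pi _ (fun i => (c i)^-1)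
   (fun i => (n i)%:R * (c i)^-1 ^+ 2) X Y.
have n_gt0 q : (0 < n q)%N.
  by have := hs p (leqnn p) q; rewrite svecE ltn_ord.
have ri_neq (i r : 'I_p) : (r < (pi^-1)%g i)%N -> pi r != i.
  by move=> ri; apply: contraTneq ri => <-; rewrite permK ltnn.
have YE (i r : 'I_p) : (r < (pi^-1)%g i)%N ->
    Y i r = X r.+1 + ((c i)^-1 - (c (pi r))^-1) *: Y i r.+1.
  move=> ri; rewrite /X /Y.
  have -> : msub n (svec pi r + unitmi i) =
      msub n (svec pi r.+1 + unitmi i) + unitmi (pi r).
    apply/ffunP => q; rewrite svecS !(msubE, miE, unitmiE, svecE).
    case: (eqVneq q (pi r)) => [->|_]; last by rewrite !addn0.
    rewrite permK ltnn (negbTE (ri_neq _ _ ri)) !addn0 add0n subn0 subnK//.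
  have -> : msub n (svec pi r.+1) =
      msub n (svec pi r.+1 + unitmi i) + unitmi i.
    apply/ffunP => q; rewrite !(msubE, miE, unitmiE, svecE).
    case: (eqVneq q i) => [->|_]; last by rewrite !addn0.
    by rewrite ltnNge ri add0n subn0 subnK.
  by rewrite !nodalD -mul_polyC rmorphB/=; ring.
have YX (i : 'I_p) : Y i ((pi^-1)%g i) = X ((pi^-1)%g i).+1.
  by rewrite /X /Y svecS permKV.
move=> /(_ YE YX).
have Y0 i : Y i 0%N = nodal c (msub n (unitmi i)) by rewrite /Y svec0 add0r.
under eq_bigr do rewrite Y0.
move=> newton; rewrite mulX_laguerreII// laguerreII_unitD// newton.
have bE j : (1 <= j < p.+1)%N ->
  coef_b alpha0 c pi j n *: laguerreII alpha0 c (msub n (svec pi j)) =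
  poch (alpha0 + 1) (mabs n) *: pochdiv alpha0 ((\sum_(i in Sset pi j)
      ((n i)%:R * (c i)^-1 ^+ 2 *
       \prod_(q in (~: Sset pi j)%SET) ((c i)^-1 - (c q)^-1))) *: X j).
  move=> jp; rewrite coef_bE// laguerreII_nodal// [in RHS]linearZ/= !scalerA.
  congr (_ *: _).
  have [_ jp'] := andP jp; rewrite ltnS in jp'.
  have jn : (j <= mabs n)%N.
    rewrite -(mabs_svec pi jp') -[in leqRHS](msubK (hs _ jp')).
    by rewrite mabsD leq_addl.
  have -> : poch (alpha0 + 1) (mabs n) =
      poch (alpha0 + 1) (mabs n - j) * poch (alpha0 + (mabs n)%:R - j%:R + 1) j.
    rewrite -[in LHS](subnK jn) pochD natrB//.
    by congr (_ * poch _ _); ring.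
  rewrite (mabs_msub (hs _ jp')) mabs_svec//; ring.
rewrite (eq_big_nat _ _ bE) -scaler_sumr -raddf_sum/=.
rewrite laguerreII_nodal// /coef_b0.
have DD := raddfD (pochdiv alpha0).
have DZ (r : R) (f : {poly R}) :
  pochdiv alpha0 (r *: f) = r *: pochdiv alpha0 f by rewrite linearZ.
rewrite !DD (raddfN (pochdiv alpha0))/= !DZ.
by rewrite -!mul_polyC !rmorphD !rmorphM/=; ring.
Qed.

(** * Truncated power series *)

Section CongruenceModXn.
Variable A : comNzRingType.
Implicit Types f g : {poly A}.

(** Power series are represented by polynomials modulo ['X^M], so identities
    between series become congruences, which multiplication respects. *)
Definition eqmodX (M : nat) f g := forall m, (m < M)%N -> f`_m = g`_m.

Lemma eqmodX_trans M f g h : eqmodX M f g -> eqmodX M g h -> eqmodX M f h.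
Proof. by move=> fg gh m mM; rewrite fg// gh. Qed.

Lemma eqmodX_add M f1 f2 g1 g2 :
  eqmodX M f1 g1 -> eqmodX M f2 g2 -> eqmodX M (f1 + f2) (g1 + g2).
Proof. by move=> h1 h2 m mM; rewrite !coefD h1// h2. Qed.

Lemma eqmodX_mul M f1 f2 g1 g2 :
  eqmodX M f1 g1 -> eqmodX M f2 g2 -> eqmodX M (f1 * f2) (g1 * g2).
Proof.
move=> h1 h2 m mM; rewrite !coefM; apply: eq_bigr => j _.
rewrite h1 ?h2//; first exact: leq_ltn_trans (leq_subr _ _) mM.
by apply: leq_ltn_trans mM; rewrite -ltnS.
Qed.

Lemma eqmodX_sum M (I : Type) (r : seq I) (P : pred I) (F G : I -> {poly A}) :
  (forall i, P i -> eqmodX M (F i) (G i)) ->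
  eqmodX M (\sum_(i <- r | P i) F i) (\sum_(i <- r | P i) G i).
Proof. by move=> h; elim/big_ind2: _ => // *; apply: eqmodX_add. Qed.

Lemma eqmodX_prod M (I : Type) (r : seq I) (P : pred I) (F G : I -> {poly A}) :
  (forall i, P i -> eqmodX M (F i) (G i)) ->
  eqmodX M (\prod_(i <- r | P i) F i) (\prod_(i <- r | P i) G i).
Proof. by move=> h; elim/big_ind2: _ => // *; apply: eqmodX_mul. Qed.

Lemma eqmodX_coefXM M f g m :
  eqmodX M f g -> (m <= M)%N -> ('X * f)`_m = ('X * g)`_m.
Proof. by move=> h; case: m => [|m] mM; rewrite !coefXM//= h. Qed.

Lemma eqmodX_poly M M' (F : nat -> A) : (M <= M')%N ->
  eqmodX M (\poly_(m < M') F m) (\poly_(m < M) F m).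
Proof. by move=> MM m mM; rewrite !coef_poly mM (leq_trans mM). Qed.

Lemma coef_mul_prod_poly (B : {poly A}) p K (g : 'I_p -> nat -> A) t :
  (B * \prod_(q < p) \poly_(m < K) g q m)`_t =
  \sum_(l : {ffun 'I_p -> 'I_K} | (\sum_(q < p) l q <= t)%N)
    B`_(t - \sum_(q < p) l q) * \prod_(q < p) g q (l q).
Proof.
under eq_bigr do rewrite poly_def.
rewrite bigA_distr_bigA/= mulr_sumr coef_sum [RHS]big_mkcond.
apply: eq_bigr => l _; rewrite scaler_prod prodrXr -scalerAr coefZ coefMXn.
by rewrite ltnNge; case: leqP => _; rewrite ?mulr0// mulrC.
Qed.

End CongruenceModXn.

Section BinomialSeries.
Variable R : realType.
Implicit Types (b d k : R) (M m : nat).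

(** The generalised binomial coefficient [b (b-1) ... (b-m+1) / m!]. *)
Definition gbin b m : R := (-1) ^+ m * poch (- b) m / m`!%:R.

Lemma gbin0 b : gbin b 0 = 1.
Proof. by rewrite /gbin /poch big_ord0 expr0 fact0 mulr1 divr1. Qed.

Lemma gbinS b m : m.+1%:R * gbin b m.+1 = (b - m%:R) * gbin b m.
Proof.
rewrite /gbin pochS exprS factS natrM.
by field; rewrite nat1r !pnatr_eq0 -!lt0n fact_gt0.
Qed.

Lemma gbinSl b m : m.+1%:R * gbin b m.+1 = b * gbin (b - 1) m.
Proof.
rewrite /gbin pochSl exprS factS natrM opprB [1 - b]addrC.
by field; rewrite nat1r !pnatr_eq0 -!lt0n fact_gt0.
Qed.

Lemma gbin_pascal b m : gbin (b + 1) m.+1 = gbin b m.+1 + gbin b m.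
Proof.
have m0 : m.+1%:R != 0 :> R by rewrite pnatr_eq0.
by apply: (mulfI m0); rewrite mulrDr (gbinSl (b + 1)) (gbinS b) addrK -natr1; ring.
Qed.

(** The series of [(d + u) ^ b] in powers of [u], truncated at [u ^ M], where
    [k] stands for the value [d ^ b]: as [d] may be negative, that value is
    supplied separately.  The coefficients are constants of [{poly R}], whose
    variable is the argument [x] of the Laguerre polynomials. *)
Definition binser M d k b : {poly {poly R}} :=
  \poly_(m < M) (k * gbin b m * d^-1 ^+ m)%:P.

(** The series of [exp (- x u)], truncated at [u ^ M]. *)
Definition expser M : {poly {poly R}} :=
  \poly_(m < M) (((-1) ^+ m / m`!%:R) *: 'X^m).

Lemma binser_mul M d k b : d != 0 ->
  eqmodX M ((d%:P%:P + 'X) * binser M d k b) (binser M d (k * d) (b + 1)).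
Proof.
move=> d0 m mM; rewrite mulrDl coefD coefCM coefXM !coef_poly mM -polyCM.
case: m mM => [|m] mM /=; first by rewrite !gbin0 addr0; congr polyC; ring.
rewrite (ltnW mM) -polyCD gbin_pascal; congr polyC; rewrite exprS.
by field.
Qed.

Lemma deriv_binser M d k b :
  eqmodX M.-1 (binser M d k b)^`()
         (b%:P%:P * binser M d (k / d) (b - 1)).
Proof.
move=> m mM; have mM' : (m.+1 < M)%N by case: (M) mM.
rewrite coef_deriv coefCM !coef_poly mM' (ltnW mM') -polyCM -polyCMn.
rewrite -mulr_natr; congr polyC.
transitivity (k * (m.+1%:R * gbin b m.+1) * d^-1 ^+ m.+1); first by ring.
by rewrite gbinSl exprS; ring.
Qed.

Lemma deriv_expser M :
  eqmodX M.-1 (expser M)^`() (- 'X%:P * expser M).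
Proof.
move=> m mM; have mM' : (m.+1 < M)%N by case: (M) mM.
rewrite coef_deriv -polyCN coefCM !coef_poly mM' (ltnW mM').
rewrite mulNr -[in RHS]scalerAr scalerMnl -mulr_natr.
rewrite -exprS -scaleNr.
congr (_ *: _); rewrite exprS factS natrM.
by field; rewrite nat1r !pnatr_eq0 -!lt0n fact_gt0.
Qed.

Lemma eqmodX_binser M M' d k b : (M <= M')%N ->
  eqmodX M (binser M' d k b) (binser M d k b).
Proof. exact: eqmodX_poly. Qed.

Lemma eqmodX_expser M M' : (M <= M')%N -> eqmodX M (expser M') (expser M).
Proof. exact: eqmodX_poly. Qed.

End BinomialSeries.

(** * Type I polynomials as residues *)

Section TypeI.
Variables (R : realType) (p : nat) (c : 'I_p -> R) (i : 'I_p).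
Hypothesis hc : forall q, 0 < c q.
Hypothesis hcinj : injective c.
Implicit Types (n : multiindex p) (b : R).

Let ci0 : c i != 0. Proof. by rewrite gt_eqF. Qed.
Let d0 q : q != i -> c i - c q != 0.
Proof. by apply: contraNneq => /subr0_eq/hcinj->. Qed.

(** With [u = t - c_i] throughout, this is the germ at [t = c_i] of
    [(t - c_q) ^ (- m)]. *)
Definition polefac M (q : 'I_p) (m : nat) : {poly {poly R}} :=
  binser M (c i - c q) ((c i - c q)^-1 ^+ m) (- m%:R).

(** The germ at [t = c_i] of
    [exp (- x (t - c_i)) t ^ b / \prod_(q != i) (t - c_q) ^ n_q]. *)
Definition germ M b n : {poly {poly R}} :=
  expser R M * binser M (c i) (c i `^ b) b
  * \prod_(q < p | q != i) polefac M q (n q).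

(** The residue at [t = c_i] of the germ divided by [u ^ n_i].  The extra
    factor ['X] makes it vanish when [n_i = 0], where there is no pole, so that
    the relations below need no case distinction. *)
Definition residue M b n : {poly R} := ('X * germ M b n)`_(n i).

Lemma polefac_mul M q m : q != i ->
  eqmodX M (((c i - c q)%:P%:P + 'X) * polefac M q m.+1) (polefac M q m).
Proof.
move=> qi; apply: eqmodX_trans; first exact: binser_mul (d0 qi).
rewrite /polefac exprSr -mulrA mulVf ?d0// mulr1.
by rewrite -natr1 opprD subrK.
Qed.

Lemma deriv_polefac M q m :
  eqmodX M.-1 (polefac M q m)^`() (- (m%:R%:P%:P * polefac M q m.+1)).
Proof.
apply: eqmodX_trans; first exact: deriv_binser.
by rewrite /polefac exprSr -opprD natr1 !polyCN mulNr.
Qed.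

Lemma germ_mul M b n :
  eqmodX M (((c i)%:P%:P + 'X) * germ M b n) (germ M (b + 1) n).
Proof.
rewrite /germ mulrA [_ * (expser R M * _)]mulrCA.
apply: eqmodX_mul => //; apply: eqmodX_mul => //.
apply: eqmodX_trans; first exact: binser_mul.
by rewrite powRD ?powRr1 ?ltW// ci0 implybT.
Qed.

Lemma germ_unitD M b n q : q != i -> germ M b (n + unitmi q) =
  expser R M * binser M (c i) (c i `^ b) b *
  (polefac M q (n q).+1 * \prod_(r < p | (r != i) && (r != q)) polefac M r (n r)).
Proof.
move=> qi; rewrite /germ (bigD1 q)//= miE unitmiE eqxx addn1.
congr (_ * (_ * _)); apply: eq_bigr => r /andP[_ /negPf rq].
by rewrite miE unitmiE rq addn0.
Qed.

Lemma germ_unitDi M b n : germ M b (n + unitmi i) = germ M b n.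
Proof.
congr (_ * _); apply: eq_bigr => r /negPf ri.
by rewrite miE unitmiE ri addn0.
Qed.

Lemma germ_pole_mul M b n q : q != i ->
  eqmodX M (((c i - c q)%:P%:P + 'X) * germ M b (n + unitmi q)) (germ M b n).
Proof.
move=> qi; rewrite germ_unitD// mulrCA /germ; apply: eqmodX_mul => //.
rewrite (bigD1 q qi)/= mulrA; apply: eqmodX_mul => //.
exact: polefac_mul.
Qed.

Lemma deriv_germ M b n :
  eqmodX M.-1 (germ M b n)^`()
    (- 'X%:P * germ M b n + b%:P%:P * germ M (b - 1) n
     - \sum_(q < p | q != i) (n q)%:R%:P%:P * germ M b (n + unitmi q)).
Proof.
rewrite {1}/germ !derivM deriv_prod mulrDl -sumrN mulr_sumr.
apply: eqmodX_add; first apply: eqmodX_add.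
- rewrite /germ !mulrA; do 2!apply: eqmodX_mul => //; exact: deriv_expser.
- rewrite /germ !mulrA [_ * expser _ _]mulrC -!mulrA.
  apply: eqmodX_mul => //; rewrite !mulrA; apply: eqmodX_mul => //.
  apply: eqmodX_trans; first exact: deriv_binser.
  by rewrite powRB ?powRr1 ?ltW// ci0 implybT.
- apply: eqmodX_sum => q qi; rewrite germ_unitD//.
  rewrite [_%:P%:P * _]mulrCA -mulrN; apply: eqmodX_mul => //.
  by rewrite mulrA -mulNr; apply: eqmodX_mul => //; exact: deriv_polefac.
Qed.

(** Both cases are [t = (t - c_q) + c_q]; for [q = i] the factor [t - c_q] is
    [u], which lowers the order of the pole. *)
Lemma residue_mul M b n q : (n i < M)%N ->
  residue M (b + 1) (n + unitmi q) =
  residue M b n + c q *: residue M b (n + unitmi q).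
Proof.
move=> nM; rewrite /residue; case: (eqVneq q i) => [->|qi].
  rewrite !germ_unitDi miE unitmiE eqxx addn1 !(coefXM _ (n i).+1)/=.
  rewrite -(germ_mul _ _ nM) mulrDl coefD coefCM mul_polyC.
  by rewrite addrC.
have -> : (n + unitmi q) i = n i by rewrite miE unitmiE eq_sym (negbTE qi) addn0.
rewrite -(eqmodX_coefXM (germ_mul b (n + unitmi q)) (ltnW nM)).
rewrite -(eqmodX_coefXM (germ_pole_mul b n qi) (ltnW nM)).
rewrite -mul_polyC -coefCM -coefD; congr (nth _ (polyseq _) _).
by rewrite polyCB polyCB; ring.
Qed.

(** The residue of a derivative is 0.  Concretely, the coefficient of
    [u ^ n_i] in [u f'], for the germ [f], is [n_i] times that in [f]; this is
    the term of index [q = i] of the sum, the other terms being the derivative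
    of the germ. *)
Lemma mulX_residue M b n : (n i < M)%N ->
  'X * residue M b n =
  b *: residue M (b - 1) n - \sum_q (n q)%:R *: residue M b (n + unitmi q).
Proof.
move=> nM.
have dE : ('X * (germ M b n)^`())`_(n i) =
    (n i)%:R *: residue M b (n + unitmi i).
  rewrite /residue germ_unitDi miE unitmiE eqxx addn1 coefXM coefXM/=.
  case: (n i) => [|m]; first by rewrite scale0r.
  by rewrite coef_deriv scaler_nat.
have := eqmodX_coefXM (@deriv_germ M b n).
move=> /(_ (n i)); rewrite dE => E.
(* The derivative is known below degree M - 1, and n_i - 1 < M - 1. *)
rewrite (bigD1 i)//= E; last by rewrite -ltnS (leq_trans nM) ?leqSpred.
rewrite !mulrDr !coefD mulrN mulr_sumr coefN coef_sum.
rewrite ['X * (- _ * _)]mulrCA ['X * (b%:P%:P * _)]mulrCA -polyCN !coefCM.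
rewrite mul_polyC.
have -> : \sum_(q < p | q != i)
    ('X * ((n q)%:R%:P%:P * germ M b (n + unitmi q)))`_(n i) =
  \sum_(q < p | q != i) (n q)%:R *: residue M b (n + unitmi q).
  apply: eq_bigr => q qi; rewrite mulrCA coefCM mul_polyC /residue.
  by rewrite miE unitmiE eq_sym (negbTE qi) addn0.
rewrite /residue; ring.
Qed.

Lemma residue_eq0 M b n : n i = 0%N -> residue M b n = 0.
Proof. by move=> n0; rewrite /residue n0 coefXM. Qed.

(** The residue at [t = c_i] of
    [exp (- x (t - c_i)) t ^ g / Q_n(1 / t)], since
    [1 / (1/t - 1/c_q) = - c_q t / (t - c_q)].  Multiplication by [y = 1 / t]
    is the shift of [g] to [g - 1]. *)
Definition scaled_residue M (g : R) n : {poly R} :=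
  ((-1) ^+ mabs n * \prod_(q < p) c q ^+ n q) *:
  residue M (g + (mabs n)%:R) n.

Lemma scaled_residue_unitD M g n q : scaled_residue M g (n + unitmi q) =
  (- ((-1) ^+ mabs n * \prod_(r < p) c r ^+ n r) * c q) *:
  residue M (g + (mabs n)%:R + 1) (n + unitmi q).
Proof.
rewrite /scaled_residue mabsD mabs_unitmi natrD addrA; congr (_ *: _).
have -> : \prod_(r < p) c r ^+ (n + unitmi q)%R r =
    c q * \prod_(r < p) c r ^+ n r.
  rewrite (bigD1 q)//= [in RHS](bigD1 q)//= miE unitmiE eqxx addn1 exprS -mulrA.
  congr (_ * (_ * _)); apply: eq_bigr => r /negPf rq.
  by rewrite miE unitmiE rq addn0.
by rewrite addn1 exprS; ring.
Qed.

(** [1 / Q_n = (y - a_q) / Q_(n + e_q)]. *)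
Lemma scaled_residue_mul M g n q : (n i < M)%N ->
  scaled_residue M g n = scaled_residue M (g - 1) (n + unitmi q)
                 - (c q)^-1 *: scaled_residue M g (n + unitmi q).
Proof.
move=> nM; have c0 : c q != 0 by rewrite gt_eqF.
rewrite !scaled_residue_unitD [g - 1 + _]addrAC subrK (residue_mul _ q nM).
rewrite /scaled_residue; set k := _ * \prod_(_ < _) _.
rewrite scalerA !scalerDr !scalerA mulrCA mulVf// mulr1.
by rewrite scaleNr [- k * c q]mulNr !scaleNr; ring.
Qed.

(** The terms [n_q / c_q] and [n_q / c_q^2] come from the identity
    [a_q y / (y - a_q) = a_q + a_q^2 / (y - a_q)], applied to each term of
    [mulX_residue]. *)
Lemma mulX_scaled_residue M g n : (n i < M)%N ->
  'X * scaled_residue M g n =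
  (g + (mabs n)%:R) *: scaled_residue M (g - 1) n
  + (\sum_q (n q)%:R / c q) *: scaled_residue M g n
  + \sum_q ((n q)%:R * (c q)^-1 ^+ 2) *: scaled_residue M g (n + unitmi q).
Proof.
move=> nM.
have E q : (n q)%:R / c q *: scaled_residue M g n
    + ((n q)%:R * (c q)^-1 ^+ 2) *: scaled_residue M g (n + unitmi q) =
  - (((-1) ^+ mabs n * \prod_(q < p) c q ^+ n q)
    *: ((n q)%:R *: residue M (g + (mabs n)%:R) (n + unitmi q))).
  rewrite {1}(scaled_residue_mul g q nM) scalerBr (scalerA _ (c q)^-1).
  rewrite expr2 mulrA subrK.
  rewrite scaled_residue_unitD [g - 1 + _]addrAC subrK !scalerA -[in RHS]scaleNr.
  congr (_ *: _); have c0 : c q != 0 by rewrite gt_eqF.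
  by field.
rewrite scaler_suml -addrA -big_split/=.
under [in RHS]eq_bigr do rewrite E.
rewrite sumrN -scaler_sumr {1 2}/scaled_residue -scalerAr.
rewrite (mulX_residue _ nM) scalerBr.
congr (_ - _); rewrite !scalerA mulrC; congr (_ *: residue _ _ _).
by ring.
Qed.

(** The coefficient of [u ^ m] in the factor of index [q] of the germ; the slot
    [q = i], where the germ has no pole factor, is taken by the exponential, so
    that the multi-index of the expansion has exactly [p] coordinates. *)
Definition germcoef n q m : {poly R} :=
  if q == i then ((-1) ^+ m / m`!%:R) *: 'X^m
  else ((c i - c q)^-1 ^+ n q * gbin (- (n q)%:R) m * (c i - c q)^-1 ^+ m)%:P.

Lemma residue_expand M b n : (0 < n i <= M)%N -> residue M b n =
  \sum_(l : {ffun 'I_p -> 'I_(n i)} | (\sum_(q < p) l q <= n i - 1)%N)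
    (c i `^ b * gbin b (n i - 1 - \sum_(q < p) l q)
       * (c i)^-1 ^+ (n i - 1 - \sum_(q < p) l q)) *:
    \prod_(q < p) germcoef n q (l q).
Proof.
move=> /andP[n0 nM].
have -> : residue M b n = (germ (n i) b n)`_(n i - 1).
  rewrite /residue coefXM (gtn_eqF n0) subn1.
  have : eqmodX (n i) (germ M b n) (germ (n i) b n).
    apply: eqmodX_mul; first apply: eqmodX_mul.
    - exact: eqmodX_expser.
    - exact: eqmodX_binser.
    - by apply: eqmodX_prod => q _; exact: eqmodX_binser.
  by apply; rewrite ltn_predL.
have -> : germ (n i) b n = binser (n i) (c i) (c i `^ b) b *
    \prod_(q < p) \poly_(m < n i) germcoef n q m.
  rewrite /germ [expser _ _ * _]mulrC -mulrA [in RHS](bigD1 i)//=.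
  congr (_ * (_ * _)).
    by apply: eq_poly => m _; rewrite /germcoef eqxx.
  apply: eq_bigr => q /negPf qi; apply: eq_poly => m _.
  by rewrite /germcoef qi.
rewrite coef_mul_prod_poly big_mkcond [RHS]big_mkcond; apply: eq_bigr => l _.
case: ifP => // ls; rewrite coef_poly.
have -> : (n i - 1 - \sum_(q < p) l q < n i)%N.
  by apply: leq_ltn_trans (leq_subr _ _) _; rewrite subn1 ltn_predL.
by rewrite mul_polyC.
Qed.

(** Multiply the series out: the factor [t ^ b] receives the part
    [m = n_i - 1 - |l|] of the degree left over by the others, and the two sums
    agree term by term. *)
Lemma laguerreI_residue alpha0 M n : -1 < alpha0 -> (n i <= M)%N ->
  laguerreI alpha0 c i n =
  - (Gamma (alpha0 + (mabs n)%:R))^-1 *: scaled_residue M (alpha0 - 1) n.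
Proof.
move=> a1 nM; rewrite /laguerreI; case: eqP => [n0|/eqP].
  by rewrite /scaled_residue residue_eq0// !scaler0.
rewrite -lt0n => n0; rewrite /scaled_residue residue_expand ?n0//.
rewrite scalerA !scaler_sumr; apply: eq_bigr => l ls.
set s := (\sum_(q < p) l q)%N in ls *; set N := mabs n.
have -> : \prod_(q < p) germcoef n q (l q) =
   germcoef n i (l i) * \prod_(q < p | q != i) germcoef n q (l q).
  by rewrite (bigD1 i).
rewrite {1}/germcoef eqxx.
have -> : \prod_(q < p | q != i) germcoef n q (l q) =
  (\prod_(q < p | q != i) ((c i - c q)^-1 ^+ n q * gbin (- (n q)%:R) (l q)
     * (c i - c q)^-1 ^+ l q))%:P.
  by rewrite rmorph_prod; apply: eq_bigr => q /negPf qi; rewrite /germcoef qi.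
rewrite [_ * _%:P]mulrC mul_polyC !scalerA; congr (_ *: _).
set m := (n i - 1 - s)%N.
have niE : n i = (s + m).+1 by rewrite /m; lia.
pose N' := (\sum_(q < p | q != i) n q)%N.
pose s' := (\sum_(q < p | q != i) l q)%N.
have NE : N = ((s + m).+1 + N')%N by rewrite /N /mabs (bigD1 i)//= -niE.
have sE : s = (l i + s')%N by rewrite /s (bigD1 i).
set Q := \prod_(q < p | q != i) (_ * gbin _ _ * _).
pose C := \prod_(q < p | q != i) c q ^+ n q.
have prodE : \prod_(q < p | q != i) (c q / (c q - c i)) ^+ n q *
    \prod_(q < p | q != i)
      (poch (n q)%:R (l q) / ((l q)`!%:R * (c i - c q) ^+ l q)) =
    (-1) ^+ (N' + s') * C * Q.
  rewrite exprD /N' /s' -!prodrXr /C /Q -!big_split/=; apply: eq_bigr => q qi.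
  have -> : c q - c i = -1 * (c i - c q) by rewrite mulN1r opprB.
  rewrite /gbin opprK !exprMn exprVn invfM invrN1 !exprMn exprVn.
  have signK : (-1) ^+ l q * (-1) ^+ l q = 1 :> R.
    by rewrite -exprMn mulrNN mul1r expr1n.
  rewrite -[LHS]mul1r -[X in X * _ = _]signK -!exprVn invfM -exprVn.
  ring.
have -> : \prod_(q < p) c q ^+ n q = c i ^+ (s + m).+1 * C.
  by rewrite (bigD1 i)//= -niE.
have signE : (-1) ^+ (s + m) * (-1) ^+ s * (-1) ^+ (N' + s') =
    - ((-1) ^+ N * (-1) ^+ l i) :> R.
  rewrite NE sE -!exprD -[RHS]mulN1r -exprS -signr_odd -[RHS]signr_odd.
  congr (_ ^+ _); rewrite !(oddD, oddS)/=.
  by case: (odd (l i)); case: (odd s'); case: (odd m); case: (odd N').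
have pochE : poch (1 *- n i + 1 : R) s = (-1) ^+ s * (s + m)`!%:R / m`!%:R.
  have -> : 1 *- n i + 1 = - (s + m)%:R :> R by rewrite niE -natr1; ring.
  rewrite poch_opp_nat -(@ffact_fact (s + m) s) ?leq_addr// addKn natrM.
  by field; rewrite pnatr_eq0 -lt0n fact_gt0.
set A := alpha0 + N%:R - (n i)%:R + 1.
have bE : gbin (alpha0 - 1 + N%:R) m = poch (A + s%:R) m / m`!%:R.
  rewrite /gbin poch_opp mulrA -exprMn mulrNN mul1r expr1n mul1r.
  congr (poch _ _ / _).
  rewrite /A niE -natr1 natrD; ring.
have A0 : poch A s != 0.
  rewrite gt_eqF// poch_gt0// /A NE niE natrD.
  have : (0 : R) <= N'%:R by [].
  lra.
have cE : c i `^ (alpha0 + N%:R) = c i `^ (alpha0 - 1 + N%:R) * c i.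
  have -> : alpha0 + N%:R = alpha0 - 1 + N%:R + 1 by ring.
  by rewrite powRD ?powRr1 ?ltW// ci0 implybT.
have ni1 : (n i - 1 = s + m)%N by rewrite /m; lia.
rewrite ni1 cE pochE bE pochD.
set T := c i `^ _; set G := Gamma _; set F := (s + m)`!%:R.
set F1 := m`!%:R; set F2 := (l i)`!%:R.
set P1 := \prod_(q < p | q != i) _ in prodE *.
set P2 := \prod_(q < p | q != i) _ in prodE *.
have F0 : F != 0 by rewrite pnatr_eq0 -lt0n fact_gt0.
have cm : c i ^+ m * (c i)^-1 ^+ m = 1 by rewrite -exprMn divff ?expr1n.
rewrite invfM.
transitivity ((-1) ^+ (s + m) * (-1) ^+ s * (P1 * P2) * (F / F)
  * (poch A s / poch A s) * (T * c i * poch (A + s%:R) m / G * c i ^+ s / F1 / F2)).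
  by ring.
rewrite prodE !divff// !mulr1 !mulrA signE exprS exprD.
transitivity (- ((-1) ^+ N * (-1) ^+ l i) * C * Q * T * c i * poch (A + s%:R) m
  / G * c i ^+ s / F1 / F2 * (c i ^+ m * (c i)^-1 ^+ m)).
  by rewrite cm mulr1.
by ring.
Qed.

End TypeI.

(** * Recurrence of the type I polynomials *)

Lemma Gamma_addn (R : realType) (x : R) j :
  0 < x -> Gamma (x + j%:R) = poch x j * Gamma x.
Proof.
move=> x0; elim: j => [|j IH]; first by rewrite addr0 /poch big_ord0 mul1r.
rewrite -natr1 addrA Gamma_add1 ?IH ?pochS ?ltr_pwDl//; ring.
Qed.

Theorem laguerreI_recurrence (R : realType) (p : nat) (alpha0 : R)
    (c : 'I_p -> R) (k : 'I_p) (pi : 'S_p) (n : multiindex p) (i : 'I_p) :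
  -1 < alpha0 -> (forall q, 0 < c q) -> injective c ->
  mle (unitmi k) n ->
  'X * laguerreI alpha0 c i n =
    laguerreI alpha0 c i (msub n (unitmi k))
    + coef_b0 alpha0 c k (msub n (unitmi k)) *: laguerreI alpha0 c i n
    + \sum_(1 <= j < p.+1)
        coef_b alpha0 c pi j (n + svec pi j.-1)
          *: laguerreI alpha0 c i (n + svec pi j).
Proof.
move=> a1 c_gt0 cinj nk.
have c0 q : c q != 0 by rewrite gt_eqF.
have niM j : ((n + svec pi j)%R i < (n i).+2)%N.
  by rewrite miE svecE -addn2 ltn_add2l ltnS leq_b1.
pose m := msub n (unitmi k).
have nE : n = m + unitmi k by rewrite msubK.
have NE : mabs n = (mabs m).+1 by rewrite nE mabsD mabs_unitmi addn1.
(* All multi-indices met below have i-th entry at most n_i + 2. *)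
pose lam := scaled_residue c i (n i).+3 (alpha0 - 1).
have lamE (u : multiindex p) : (u i <= (n i).+3)%N ->
    laguerreI alpha0 c i u = - (Gamma (alpha0 + (mabs u)%:R))^-1 *: lam u.
  by move=> uM; rewrite (laguerreI_residue c_gt0 a1 uM).
set x := alpha0 + (mabs n)%:R.
have x0 : 0 < x by rewrite /x NE -natr1; have : (0 : R) <= (mabs m)%:R by []; lra.
pose X j := lam (n + svec pi j).
pose Y q j := lam (n + svec pi j + unitmi q).
have YE (q r : 'I_p) : (r < (pi^-1)%g q)%N ->
    Y q r = X r.+1 + ((c q)^-1 - (c (pi r))^-1) *: Y q r.+1.
  move=> _; rewrite /X /Y svecS.
  set u := n + svec pi r.
  have -> : n + (svec pi r + unitmi (pi r)) = u + unitmi (pi r) by rewrite addrA.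
  have uM s : ((u + unitmi s)%R i < (n i).+3)%N.
    by rewrite miE unitmiE -[(n i).+3]addn1 -addSn leq_add ?leq_b1 ?niM.
  rewrite /lam [LHS](scaled_residue_mul c_gt0 cinj _ (pi r) (uM q)).
  rewrite [X in _ = X + _](scaled_residue_mul c_gt0 cinj _ q (uM (pi r))).
  rewrite -!addrA [unitmi q + _]addrC -!mul_polyC polyCB; ring.
have YX (q : 'I_p) : Y q ((pi^-1)%g q) = X ((pi^-1)%g q).+1.
  by rewrite /X /Y svecS permKV addrA.
have := @sum_newton_expansion R p pi _ (fun q => (c q)^-1)
   (fun q => (n q)%:R * (c q)^-1 ^+ 2) X Y YE YX.
have Y0 q : Y q 0%N = lam (n + unitmi q) by rewrite /Y svec0 addr0.
under eq_bigr do rewrite Y0.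
move=> newton.
have bE j : (1 <= j < p.+1)%N ->
  coef_b alpha0 c pi j (n + svec pi j.-1) *: laguerreI alpha0 c i (n + svec pi j)
  = - (Gamma x)^-1 *: ((\sum_(q in Sset pi j)
      ((n q)%:R * (c q)^-1 ^+ 2 *
       \prod_(r in (~: Sset pi j)%SET) ((c q)^-1 - (c r)^-1))) *: X j).
  case: j => [//|j] /= jp; rewrite ltnS in jp.
  rewrite coef_bE// lamE; last by apply: leq_trans (ltnW (niM _)) _; lia.
  rewrite -/(X j.+1); move: (X j.+1) => v.
  rewrite !mabsD !mabs_svec ?(ltnW jp)// !scalerA; congr (_ *: _).
  have -> : alpha0 + (mabs n + j)%:R - j.+1%:R + 1 = x.
    by rewrite natrD -natr1 /x; ring.
  rewrite natrD addrA -/x Gamma_addn// invfM.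
  have -> : \sum_(q in Sset pi j.+1) ((n + svec pi j)%R q)%:R * (c q)^-1 ^+ 2 *
       \prod_(r in (~: Sset pi j.+1)%SET) ((c q)^-1 - (c r)^-1) =
     \sum_(q in Sset pi j.+1) (n q)%:R * (c q)^-1 ^+ 2 *
       \prod_(r in (~: Sset pi j.+1)%SET) ((c q)^-1 - (c r)^-1).
    apply: eq_bigr => q; rewrite in_Sset ltnS => qj.
    by rewrite miE svecE ltnNge qj addn0.
  set S := \sum_(_ in _) _.
  have p0 : poch x j.+1 != 0 by rewrite gt_eqF ?poch_gt0.
  transitivity (- (Gamma x)^-1 * S * (poch x j.+1 / poch x j.+1)); first by ring.
  by rewrite divff// mulr1.
rewrite (eq_big_nat _ _ bE) -scaler_sumr -newton.
(* If m_i = 0 both sides vanish; Gamma(x - 1) may then be evaluated outside the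
   domain of the functional equation. *)
have mE : laguerreI alpha0 c i m = - ((x - 1) / Gamma x) *: lam m.
  have mi : (m i <= (n i).+3)%N by rewrite [in leqRHS]nE miE; lia.
  rewrite lamE//; case: (posnP (m i)) => [mi0|mi0].
    by rewrite /lam /scaled_residue residue_eq0// !scaler0.
  have xE : x = alpha0 + (mabs m)%:R + 1 by rewrite /x NE -natr1 addrA.
  have m1 : (0 < mabs m)%N by rewrite /mabs (bigD1 i)//= addn_gt0 mi0.
  have y0 : 0 < alpha0 + (mabs m)%:R.
    by move: m1; rewrite -(ler_nat R) => ?; lra.
  rewrite xE addrK Gamma_add1// invfM mulrA divff ?mul1r// gt_eqF//.
rewrite mE lamE; last by lia.
rewrite -/x /coef_b0 -/m -scalerAr.
rewrite [X in _ *: X = _](mulX_scaled_residue c_gt0 cinj); last by lia.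
have mlam : lam m =
    scaled_residue c i (n i).+3 (alpha0 - 1 - 1) n - (c k)^-1 *: lam n.
  by rewrite /lam (scaled_residue_mul c_gt0 cinj _ k) -?nE// [in ltnRHS]nE miE; lia.
have sumE : \sum_(q < p) (m q)%:R / c q = \sum_(q < p) (n q)%:R / c q - (c k)^-1.
  rewrite (bigD1 k)//= [in RHS](bigD1 k)//= nE miE unitmiE eqxx natrD mulrDl mul1r.
  rewrite addrAC addrK; congr (_ + _).
  by apply: eq_bigr => q /negPf qk; rewrite miE unitmiE qk addn0.
rewrite mlam sumE -/(lam n).
have -> : alpha0 + (mabs m)%:R + 1 = x by rewrite /x NE -natr1 addrA.
have -> : alpha0 - 1 + (mabs n)%:R = x - 1 by rewrite /x; ring.
set S := \sum_(q < p) (n q)%:R / c q.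
rewrite -[\sum_q _ *: scaled_residue _ _ _ _ _]/(\sum_q
  ((n q)%:R * (c q)^-1 ^+ 2) *: lam (n + unitmi q)).
set W := \sum_q _ *: lam _.
move: (scaled_residue _ _ _ _ _) (lam n) => v' v; rewrite -!mul_polyC.
rewrite !(polyCN, polyCM, polyCB, polyCD); ring.
Qed.

(** * The recurrence relations *)

Theorem theorem4p2 (R : realType) (p : nat) (alpha0 : R) (c : 'I_p -> R)
    (halpha0 : -1 < alpha0) (hc : forall i : 'I_p, 0 < c i)
    (hcinj : injective c) (k : 'I_p) (pi : 'S_p) :
  (forall n : multiindex p,
     (forall j : nat, (1 <= j <= p)%N -> mle (svec pi j) n) ->
     'X * laguerreII alpha0 c n =
       laguerreII alpha0 c (n + unitmi k)
       + coef_b0 alpha0 c k n *: laguerreII alpha0 c n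
       + \sum_(1 <= j < p.+1)
           coef_b alpha0 c pi j n *: laguerreII alpha0 c (msub n (svec pi j)))
  /\
  (forall (n : multiindex p) (i : 'I_p),
     mle (unitmi k) n ->
     'X * laguerreI alpha0 c i n =
       laguerreI alpha0 c i (msub n (unitmi k))
       + coef_b0 alpha0 c k (msub n (unitmi k)) *: laguerreI alpha0 c i n
       + \sum_(1 <= j < p.+1)
           coef_b alpha0 c pi j (n + svec pi j.-1)
             *: laguerreI alpha0 c i (n + svec pi j)).
Proof.
split=> [n hn|n i hn]; first exact: laguerreII_recurrence.
exact: laguerreI_recurrence.
Qed.
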